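(* Let $G$ be a finite simple graph with $n\geq 1$ vertices and with closed and open neighborhood hypergraphs $H$ and $H^o$, respectively, and let $\delta^{**}(H)=\min\{\check{\delta}(H),\check{\delta}(H^o)\}$. Then the following hold. (i) For every integer $0\le j\le \gamma^{LD}(G)$, $$\gamma^{LD}(G)\ge \frac{n+\delta^{**}(H)\, j-T[H,j]}{\delta^{**}(H)+1}.$$ (ii) If $H$ has no multiple edges (i.e. $N[x]\ne N[y]$ for distinct vertices $x,y$), then for every integer $0\le j\le \gamma^{ID}(G)$, $$\gamma^{ID}(G)\ge \max\left\{\frac{n-T[H,j]}{\check{\delta}(H)}+j,\ \frac{n+\delta^{**}(H)\, j-T[H,j]}{\delta^{**}(H)+1}\right\}.$$ (iii) If $H^o$ has no multiple edges (i.e. $N(x)\neq N(y)$ for distinct vertices $x,y$) and $G$ has no isolated vertices, then for every integer $0\le j\le \gamma^{OLD}(G)$, $$\gamma^{OLD}(G)\ge \max\left\{\frac{n-T[H^o,j]}{\check{\delta}(H^o)}+j,\ \frac{n+\delta^{**}(H)\, j-T[H,j]}{\delta^{**}(H)+1}\right\}.$$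
   Context: Hypergraph notions: a hypergraph $H=(V,E)$ has a finite vertex set $V$ and edges that are subsets of $V$. For $S\subseteq V$ and $e\in E$, the trace of $e$ on $S$ is $e\cap S$. The induced subhypergraph $H[S]$ is the hypergraph on vertex set $S$ whose edges are the distinct traces of edges of $H$ on $S$. The degree of a vertex is the number of edges containing it. The pseudo induced subhypergraph of $H$ on $S$ has vertex set $S$ and its edges are the edges $e$ of $H$ with $e\subseteq S$. The pseudo degeneracy $\delta^*(H)$ is the largest minimum degree over all pseudo induced subhypergraphs of $H$ (with non-empty vertex set). The reduced degeneracy $\check{\delta}(H)$ is the largest pseudo degeneracy $\delta^*(H[U])$ over all induced subhypergraphs $H[U]$, $\emptyset\neq U\subseteq V$. The trace function $T[H,k]$ is the largest number of distinct non-empty traces of edges of $H$ on a set $S\subseteq V$ with $|S|=k$. Graph notions: for a graph $G$ on vertex set $V$ and $x\in V$, $N(x)$ is the set of vertices adjacent to $x$ and $N[x]=N(x)\cup\{x\}$. The closed (open) neighborhood hypergraph of $G$ has vertex set $V$ and edges the $n$ closed (open) neighborhoods of the vertices of $G$. A set $S\subseteq V$ is dominating if $N[x]\cap S\neq\emptyset$ for all $x\in V$, and total dominating if $N(x)\cap S\ne\emptyset$ for all $x\in V$. $S$ is locative if $N(x)\cap S\neq N(y)\cap S$ for all distinct $x,y\in V\setminus S$, and totally locative if $N(x)\cap S\ne N(y)\cap S$ for all distinct $x,y\in V$. $\gamma^{LD}(G)$ is the minimum size of a set that is dominating and locative (locating dominating set). $\gamma^{ID}(G)$ is the minimum size of an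 identifying code, i.e. a dominating set $S$ with $N[x]\cap S\neq N[y]\cap S$ for all distinct $x,y\in V$. $\gamma^{OLD}(G)$ is the minimum size of a set that is total dominating and totally locative (open locating dominating set). *)

(* Defs.v *)
From mathcomp Require Import all_boot.

Set Implicit Arguments.
Unset Strict Implicit.
Unset Printing Implicit Defensive.

Section Hypergraph.
Variable V : finType.

(* The edges form a sequence, so that multiple edges are allowed; the vertex
   set is a subset of V, so that subhypergraphs live over the same type. *)
Record hypergraph := Hypergraph {
  vertices : {set V};
  edges : seq {set V};
  edges_sub : all (fun e : {set V} => e \subset vertices) edges }.

Implicit Types (H : hypergraph) (S : {set V}).

Definition no_multiple_edges H : bool := uniq (edges H).

Definition trace S (e : {set V}) : {set V} := e :&: S.

Fact induced_sub H S :
  all (fun e : {set V} => e \subset S) (undup [seq trace S e | e <- edges H]).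
Proof.
by apply/allP=> e; rewrite mem_undup => /mapP[f _ ->]; apply: subsetIr.
Qed.

Definition induced H S : hypergraph := Hypergraph (induced_sub H S).

Fact pseudo_induced_sub H S :
  all (fun e : {set V} => e \subset S)
    [seq e : {set V} <- edges H | e \subset S].
Proof. exact: filter_all. Qed.

Definition pseudo_induced H S : hypergraph :=
  Hypergraph (pseudo_induced_sub H S).

Definition degree H (x : V) : nat := count (fun e : {set V} => x \in e) (edges H).

(* No degree exceeds the number of edges, so the default value matters only
   when the vertex set is empty. *)
Definition min_degree H : nat :=
  \big[minn/size (edges H)]_(x in vertices H) degree H x.

Definition pseudo_degeneracy H : nat :=
  \max_(S : {set V} | (S \subset vertices H) && (S != set0))
    min_degree (pseudo_induced H S).

Definition reduced_degeneracy H : nat :=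
  \max_(U : {set V} | (U \subset vertices H) && (U != set0))
    pseudo_degeneracy (induced H U).

Definition trace_function H (k : nat) : nat :=
  \max_(S : {set V} | (S \subset vertices H) && (#|S| == k))
    count (fun e : {set V} => e != set0) (edges (induced H S)).

End Hypergraph.

(* A finite simple graph on V is given by its adjacency relation, to be assumed
   symmetric and irreflexive. *)
Section Graph.
Variables (V : finType) (adj : rel V).

Implicit Types (S : {set V}).

Definition open_nbh (x : V) : {set V} := [set y | adj x y].

Definition closed_nbh (x : V) : {set V} := x |: open_nbh x.

Fact nbh_sub (N : V -> {set V}) :
  all (fun e : {set V} => e \subset [set: V]) [seq N x | x <- enum V].
Proof. by apply/allP=> e _; apply: subsetT. Qed.

Definition closed_nbh_hypergraph : hypergraph V :=
  Hypergraph (nbh_sub closed_nbh).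

Definition open_nbh_hypergraph : hypergraph V :=
  Hypergraph (nbh_sub open_nbh).

Definition dominating S : bool := [forall x, closed_nbh x :&: S != set0].

Definition total_dominating S : bool := [forall x, open_nbh x :&: S != set0].

Definition locative S : bool :=
  [forall x in ~: S, forall y in ~: S,
    (x != y) ==> (open_nbh x :&: S != open_nbh y :&: S)].

Definition totally_locative S : bool :=
  [forall x, forall y, (x != y) ==> (open_nbh x :&: S != open_nbh y :&: S)].

Definition locating_dominating S : bool := dominating S && locative S.

Definition identifying_code S : bool :=
  dominating S &&
  [forall x, forall y,
    (x != y) ==> (closed_nbh x :&: S != closed_nbh y :&: S)].

Definition open_locating_dominating S : bool :=
  total_dominating S && totally_locative S.

(* No set has more than #|V| elements, so the default value matters only when
   no set satisfies P. *)
Definition min_size (P : pred {set V}) : nat :=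
  \big[minn/#|V|]_(S : {set V} | P S) #|S|.

Definition gammaLD : nat := min_size locating_dominating.

Definition gammaID : nat := min_size identifying_code.

Definition gammaOLD : nat := min_size open_locating_dominating.

Definition delta_star_star : nat :=
  minn (reduced_degeneracy closed_nbh_hypergraph)
       (reduced_degeneracy open_nbh_hypergraph).

End Graph.

(* Main.v *)
(* Deleting from [U] a vertex [x] merges or destroys only traces on [U] that
   contain [x], so it costs at most the degree of [x] among those traces.  Every
   nonempty [U] has a vertex whose degree is at most the reduced degeneracy, so
   shrinking a code [S] to [j] vertices loses at most
   [reduced_degeneracy * (#|S| - j)] traces, while at most the trace function at
   [j] of them remain.  For the bounds involving [delta_star_star], only the
   neighborhoods of the vertices outside [S] are traced: on subsets of [S] their
   open and closed versions coincide, so either degeneracy can be used. *)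
Require Import Defs.
From mathcomp Require Import all_boot all_order all_algebra.
From mathcomp Require Import lra zify.
Set Implicit Arguments.
Unset Strict Implicit.
Unset Printing Implicit Defensive.
Import Order.TTheory GRing.Theory Num.Theory.
Local Open Scope ring_scope.

(** The bound by [m] keeps the default from undercutting the values of [F], so the minimum is one of
    them. This serves both minimum degrees and minimum code sizes. *)
Lemma bigminn_attained (I : finType) (P : pred I) (F : I -> nat) (m : nat)
    (i0 : I) :
  P i0 -> (forall i, P i -> F i <= m)%N ->
  exists2 i, P i & F i = \big[minn/m]_(i | P i) F i.
Proof.
move=> Pi0 leFm.
have Em: \big[minn/m]_(i | P i) F i = \big[Order.min/m]_(i | P i) F i.
  by apply: (eq_big_op (fun _ => True)) => // a b _ _; rewrite minEnat.
rewrite Em (bigmin_eq_arg m i0) //.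
by case: (arg_minP F Pi0) => i Pi _; exists i.
Qed.

(** * Counting traces under vertex deletion *)

Section Traces.
Variable V : finType.
Implicit Types (F : {set {set V}}) (U S : {set V}) (H : hypergraph V).

Definition traces F U : {set {set V}} := [set e :&: U | e in F].

Definition nonempty_traces F U : {set {set V}} := traces F U :\ set0.

Lemma card_nonempty_traces_setD1 F U x :
  (#|nonempty_traces F U| <=
     #|nonempty_traces F (U :\ x)| + #|[set e in traces F U | x \in e]|)%N.
Proof.
apply: leq_trans (leq_card_setU _ _); apply/subset_leq_card/subsetP => e.
rewrite !inE => /andP[e0 eU]; rewrite e0 eU /=.
case: (boolP (x \in e)) => xe; rewrite ?orbT // orbF.
case/imsetP: eU => f fF Ee; apply/imsetP; exists f => //.
by rewrite setIDA -Ee; apply/esym/setDidPl; rewrite disjoint_sym disjoints1.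
Qed.

Lemma card_nonempty_traces_shrink F S (d : nat) :
  (forall U, U \subset S -> U != set0 ->
     exists2 x, x \in U & (#|[set e in traces F U | x \in e]| <= d)%N) ->
  forall j, (j <= #|S|)%N ->
  exists U, [/\ U \subset S, #|U| = j &
    (#|nonempty_traces F S| <= #|nonempty_traces F U| + d * (#|S| - j))%N].
Proof.
(* Rewriting [j] as [#|S| - (#|S| - j)] allows induction on the number [k] of deleted vertices. As
   long as [k < #|S|], a vertex is left to delete. *)
move=> low_deg j lejS; rewrite -(subKn lejS).
elim: (#|S| - j)%N (leq_subr j #|S|) => {j lejS} [|k IHk] ltkS.
  by exists S; rewrite !subn0 subnn muln0 addn0.
have [U [US cardU leU]] := IHk (ltnW ltkS).
have U0 : U != set0 by rewrite -card_gt0 cardU subn_gt0.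
have [x xU degx] := low_deg U US U0.
exists (U :\ x); split.
- exact: subset_trans (subsetDl _ _) US.
- by move: (cardsD1 x U); rewrite xU cardU; lia.
- have := card_nonempty_traces_setD1 F U x.
  move: leU; rewrite !subKn ?(ltnW ltkS) // mulnS; lia.
Qed.

Lemma min_degree_attained H :
  vertices H != set0 -> exists2 x, x \in vertices H & degree H x = min_degree H.
Proof.
case/set0Pn=> x0 x0H; apply: (bigminn_attained x0H) => x _.
exact: count_size.
Qed.

Lemma min_degree_induced_le H U :
  U \subset vertices H -> U != set0 ->
  (min_degree (induced H U) <= reduced_degeneracy H)%N.
Proof.
move=> UH U0.
apply: (bigop.bigmax_sup U); first by rewrite UH.
(* In both maxima the witness is [U] itself: every edge of [induced H U] lies in [U], so the pseudo
   induced subhypergraph on [U] keeps them all. *)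
apply: (bigop.bigmax_sup U); first by rewrite subxx.
rewrite /min_degree /degree /=.
by rewrite (all_filterP (induced_sub H U)).
Qed.

Lemma card_count_induced H F U (p : pred {set V}) :
  {subset traces F U <= edges (induced H U)} ->
  (#|[set e in traces F U | p e]| <= count p (edges (induced H U)))%N.
Proof.
move=> FH; rewrite -size_filter cardE uniq_leq_size ?enum_uniq // => e.
by rewrite mem_enum inE mem_filter => /andP[/FH-> ->].
Qed.

(** Only the traces of [F] on [U] are compared with [H], and [F] may contain sets that are not edges
    of [H]. This lets a family of closed neighborhoods be measured by the degeneracy of the open
    neighborhood hypergraph. *)
Lemma low_degree_vertex H F U :
  {subset traces F U <= edges (induced H U)} ->
  U \subset vertices H -> U != set0 ->
  exists2 x, x \in U &
    (#|[set e in traces F U | x \in e]| <= reduced_degeneracy H)%N.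
Proof.
move=> FH UH U0.
have [x xU degx] := @min_degree_attained (induced H U) U0.
exists x => //; apply: leq_trans (min_degree_induced_le UH U0).
by rewrite -degx; apply: card_count_induced.
Qed.

Lemma card_nonempty_traces_le H F U :
  {subset traces F U <= edges (induced H U)} -> U \subset vertices H ->
  (#|nonempty_traces F U| <= trace_function H #|U|)%N.
Proof.
move=> FH UH.
apply: (@leq_trans (count (fun e => e != set0) (edges (induced H U)))).
  apply: leq_trans (card_count_induced _ FH).
  by apply/subset_leq_card/subsetP=> e; rewrite !inE andbC.
by apply: (bigop.bigmax_sup U); rewrite ?UH ?eqxx.
Qed.

Lemma card_nonempty_traces_imset (N : V -> {set V}) (A S : {set V}) :
  {in A, forall x, N x :&: S != set0} ->
  {in A &, injective (fun x => N x :&: S)} ->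
  #|nonempty_traces (N @: A) S| = #|A|.
Proof.
move=> N0 Ninj; rewrite -(card_in_imset Ninj).
rewrite /nonempty_traces /traces -imset_comp.
apply: eq_card => e; rewrite !inE andb_idl // => /imsetP[x xA ->].
exact: N0.
Qed.

End Traces.

(** * Neighborhood hypergraphs and codes *)

Section Codes.
Variables (V : finType) (adj : rel V).
Implicit Types (N : V -> {set V}) (S U A : {set V}).

Let H := closed_nbh_hypergraph adj.
Let Ho := open_nbh_hypergraph adj.
Let d := delta_star_star adj.

Lemma traces_nbh_sub N A U :
  {subset traces (N @: A) U <= edges (induced (Hypergraph (nbh_sub N)) U)}.
Proof.
move=> e /imsetP[f /imsetP[x _ ->] ->]; rewrite mem_undup.
by do 2![apply: map_f]; rewrite mem_enum.
Qed.

Lemma closed_nbhI S x :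
  x \notin S -> closed_nbh adj x :&: S = open_nbh adj x :&: S.
Proof.
move=> xS; rewrite setIUl; apply/setUidPr; apply: (subset_trans _ (sub0set _)).
by rewrite subset0 setI_eq0 disjoints1.
Qed.

Lemma traces_closed_nbh A U :
  [disjoint A & U] ->
  traces (closed_nbh adj @: A) U = traces (open_nbh adj @: A) U.
Proof.
move=> disAU; rewrite /traces -!imset_comp; apply: eq_in_imset => x xA /=.
by rewrite closed_nbhI ?(disjointFr disAU).
Qed.

(** All vertices are traced here, including those of [S], for which open and closed traces may
    differ. The degeneracy and the trace function are therefore those of the hypergraph of [N]
    itself. *)
Lemma separating_bound N S j :
  (forall x, N x :&: S != set0) -> injective (fun x => N x :&: S) ->
  (j <= #|S|)%N ->
  (#|V| <= trace_function (Hypergraph (nbh_sub N)) j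
           + reduced_degeneracy (Hypergraph (nbh_sub N)) * (#|S| - j))%N.
Proof.
move=> N0 Ninj lejS; rewrite -cardsT.
rewrite -(card_nonempty_traces_imset (A := [set: V]) (in1W N0)); last first.
  by move=> x y _ _; apply: Ninj.
have [|U [_ <- leS]] := @card_nonempty_traces_shrink _ (N @: setT) S
    (reduced_degeneracy (Hypergraph (nbh_sub N))) _ j lejS.
  move=> U _ U0; apply: low_degree_vertex => //; last exact: subsetT.
  exact: traces_nbh_sub.
apply: leq_trans leS _; rewrite leq_add2r card_nonempty_traces_le ?subsetT //.
exact: traces_nbh_sub.
Qed.

(** The vertices of [S] are paid for by the summand [#|S|], and those outside [S] have distinct
    nonempty traces. No minimality of [S] is assumed, so the bound also applies to identifying and
    open locating dominating codes. *)
Lemma locating_dominating_bound S j :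
  locating_dominating adj S -> (j <= #|S|)%N ->
  (#|V| <= #|S| + trace_function H j + d * (#|S| - j))%N.
Proof.
case/andP=> /forallP dom /forall_inP loc lejS.
pose F := closed_nbh adj @: ~: S.
have FHo U : U \subset S -> {subset traces F U <= edges (induced Ho U)}.
  move=> US; rewrite traces_closed_nbh; first exact: traces_nbh_sub.
  by rewrite disjoint_sym disjoints_subset setCK.
have cardF : #|nonempty_traces F S| = #|~: S|.
  apply: card_nonempty_traces_imset => [x _|x y xS yS /= Exy]; first exact: dom.
  apply/eqP; apply: contraT => xy.
  have /implyP/(_ xy)/negP[] := forall_inP (loc x xS) y yS.
  by rewrite -!closed_nbhI ?Exy // -in_setC.
have [|U [_ <- leS]] := @card_nonempty_traces_shrink _ F S d _ j lejS.
  (* Whichever hypergraph attains the minimum supplies the vertex of low degree, since the traces of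
     [F] on [U] are edges of both [induced H U] and [induced Ho U]. *)
  move=> U US U0; rewrite /d /delta_star_star /minn; case: ifP => _.
    by apply: low_degree_vertex => //; [exact: traces_nbh_sub | exact: subsetT].
  by apply: low_degree_vertex => //; [exact: FHo | exact: subsetT].
have leU: (#|nonempty_traces F U| <= trace_function H #|U|)%N.
  by apply: card_nonempty_traces_le; [exact: traces_nbh_sub | exact: subsetT].
by move: leS leU (cardsC S); rewrite cardF; lia.
Qed.

Lemma identifying_code_locating S :
  identifying_code adj S -> locating_dominating adj S.
Proof.
case/andP=> dom /forallP sep; rewrite /locating_dominating dom.
apply/forall_inP=> x xS; apply/forall_inP=> y yS; apply/implyP=> xy.
by rewrite -!closed_nbhI ?(implyP (forallP (sep x) y)) // -in_setC.
Qed.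

Lemma open_locating_dominating_locating S :
  open_locating_dominating adj S -> locating_dominating adj S.
Proof.
case/andP=> /forallP dom /forallP sep; apply/andP; split.
  apply/forallP=> x; apply: contra (dom x); rewrite -!subset0.
  by apply/subset_trans/setSI/subsetUr.
by apply/forall_inP=> x xS; apply/forall_inP=> y yS; apply: (forallP (sep x)).
Qed.

(** An admissible set must exist for the minimum size to be attained; for the full vertex set,
    locativity is vacuous. *)
Lemma locating_dominatingT : locating_dominating adj setT.
Proof.
apply/andP; split.
  by apply/forallP=> x; apply/set0Pn; exists x; rewrite setIT setU11.
by apply/forall_inP=> x; rewrite setCT inE.
Qed.

(** The absence of repetitions in the list of all [N x] is, up to conversion, the boolean
    injectivity test of [N]. *)
Lemma nbh_inj N :
  no_multiple_edges (Hypergraph (nbh_sub N)) -> injective N.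
Proof. by move/injectiveP. Qed.

Lemma separating_inj N S :
  [forall x, forall y, (x != y) ==> (N x :&: S != N y :&: S)] ->
  injective (fun x => N x :&: S).
Proof.
move=> /forallP sep x y Exy; apply: contraTeq (sep x) => xy.
by apply/forallPn; exists y; rewrite xy Exy /= eqxx.
Qed.

Lemma identifying_codeT :
  injective (closed_nbh adj) -> identifying_code adj setT.
Proof.
move=> Ninj; apply/andP; split; first by case/andP: locating_dominatingT.
by apply/forallP=> x; apply/forallP=> y; rewrite !setIT (inj_eq Ninj) implybb.
Qed.

Lemma open_locating_dominatingT :
  injective (open_nbh adj) -> (forall x, exists y, adj x y) ->
  open_locating_dominating adj setT.
Proof.
move=> Ninj no_iso; apply/andP; split.
  apply/forallP=> x; have [y xy] := no_iso x.
  by apply/set0Pn; exists y; rewrite setIT inE.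
by apply/forallP=> x; apply/forallP=> y; rewrite !setIT (inj_eq Ninj) implybb.
Qed.

Lemma min_size_attained (P : pred {set V}) S0 :
  P S0 -> exists2 S, P S & #|S| = min_size P.
Proof.
by move=> PS0; apply: bigminn_attained PS0 _ => S _; apply: max_card.
Qed.

End Codes.

(** * From natural number bounds to rational quotients *)

Lemma locating_ratio (n d j t s : nat) :
  (j <= s)%N -> (n <= s + t + d * (s - j))%N ->
  (n%:R + d%:R * j%:R - t%:R) / (d%:R + 1) <= s%:R :> rat.
Proof.
move=> lejs le_n; rewrite ler_pdivrMr; last by rewrite ltr_wpDl.
(* With [s = j + k], the claim becomes linear once [d * j] and [d * k] are treated as atoms. *)
rewrite -(subnKC lejs) in le_n *; move: (s - j)%N le_n => k.
rewrite addKn -(ler_nat rat) !natrD !natrM; lra.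
Qed.

(* For [d = 0] the quotient is [0] by the convention on division by zero. *)
Lemma separating_ratio (n d j t s : nat) :
  (j <= s)%N -> (n <= t + d * (s - j))%N ->
  (n%:R - t%:R) / d%:R + j%:R <= s%:R :> rat.
Proof.
move=> lejs; case: d => [|d] le_n; first by rewrite invr0 mulr0 add0r ler_nat.
rewrite -lerBrDr ler_pdivrMr ?ltr0Sn // lerBlDl -(natrB _ lejs) -natrM -natrD.
by rewrite ler_nat mulnC.
Qed.

Theorem theorem4p1 (V : finType) (adj : rel V)
    (adj_sym : symmetric adj) (adj_irr : irreflexive adj)
    (n : nat) (cardV : #|V| = n) (n_ge1 : (1 <= n)%N) :
  let H := closed_nbh_hypergraph adj in
  let Ho := open_nbh_hypergraph adj in
  let d := delta_star_star adj in
  [/\ forall j : nat, (j <= gammaLD adj)%N ->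
        (n%:R + d%:R * j%:R - (trace_function H j)%:R) / (d%:R + 1)
          <= (gammaLD adj)%:R :> rat,
      no_multiple_edges H ->
      forall j : nat, (j <= gammaID adj)%N ->
        Num.max
          ((n%:R - (trace_function H j)%:R) / (reduced_degeneracy H)%:R + j%:R)
          ((n%:R + d%:R * j%:R - (trace_function H j)%:R) / (d%:R + 1))
          <= (gammaID adj)%:R :> rat
    & no_multiple_edges Ho -> (forall x : V, exists y : V, adj x y) ->
      forall j : nat, (j <= gammaOLD adj)%N ->
        Num.max
          ((n%:R - (trace_function Ho j)%:R) / (reduced_degeneracy Ho)%:R
             + j%:R)
          ((n%:R + d%:R * j%:R - (trace_function H j)%:R) / (d%:R + 1))
          <= (gammaOLD adj)%:R :> rat].
Proof.
move=> H Ho d; rewrite -cardV /gammaLD /gammaID /gammaOLD.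
split=> [j|uniqH j|uniqHo no_iso j].
- have [S LD <-] := min_size_attained (locating_dominatingT adj).
  by move=> lejS; apply: locating_ratio (locating_dominating_bound LD _).
- have [S ID <-] := min_size_attained (identifying_codeT (nbh_inj uniqH)).
  move=> lejS; rewrite ge_max; apply/andP; split; last first.
    (* Here [j] may exceed [gammaLD adj], so the first part of the theorem does not suffice; the
       bound is applied to the code [S] itself. *)
    apply: locating_ratio (locating_dominating_bound _ _) => //.
    exact: identifying_code_locating.
  case/andP: ID => /forallP dom sep.
  apply: separating_ratio (separating_bound _ _ _) => //.
  exact: separating_inj.
- have [S OLD <-] := min_size_attained
    (open_locating_dominatingT (nbh_inj uniqHo) no_iso).
  move=> lejS; rewrite ge_max; apply/andP; split; last first.
    apply: locating_ratio (locating_dominating_bound _ _) => //.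
    exact: open_locating_dominating_locating.
  case/andP: OLD => /forallP dom sep.
  apply: separating_ratio (separating_bound _ _ _) => //.
  exact: separating_inj.
Qed.
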